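(* Let $R\subset S$ be an FCP extension of rings and let $\overline R$ be the integral closure of $R$ in $S$. Then $R\subset S$ is a $\Delta$-extension if and only if $R\subseteq\overline R$ is a $\Delta$-extension.
   Context: All rings are commutative and unital. For a ring extension $R\subseteq S$, $[R,S]$ denotes the set of all $R$-subalgebras of $S$ (rings $T$ with $R\subseteq T\subseteq S$), ordered by inclusion. The extension is FCP if every chain in $[R,S]$ is finite. It is a $\Delta$-extension if $T+U\in[R,S]$ for all $T,U\in[R,S]$ (equivalently $T+U=TU$, where $TU$ is the compositum). *)

(* Defs.v *)
From mathcomp Require Import all_boot all_algebra all_classical.

Set Implicit Arguments.
Unset Strict Implicit.
Unset Printing Implicit Defensive.

Import GRing.Theory.

Local Open Scope classical_set_scope.
Local Open Scope ring_scope.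

(* A ring extension R <= S is given by two subsets R, S of an ambient
   commutative ring A that are subrings of A; the top ring of an extension may
   be the whole ambient ring, in which case S is [set: A]. *)
Section RingExtensions.
Variable A : comNzRingType.
Implicit Types R S T U : set A.

Definition is_subring T : Prop := GRing.subring_closed [in T].

Definition intermediate_rings R S : set (set A) :=
  [set T | [/\ is_subring T, R `<=` T & T `<=` S]].

Definition FCP R S : Prop :=
  forall C : set (set A),
    C `<=` intermediate_rings R S -> total_on C subset -> finite_set C.

Definition sumset T U : set A := [set t + u | t in T & u in U].

Definition Delta_extension R S : Prop :=
  forall T U, intermediate_rings R S T -> intermediate_rings R S U ->
    intermediate_rings R S (sumset T U).

(* mxpoly.integralOver is stated for a morphism between ring types; this is its
   counterpart for a subset R of A. *)
Definition integral_over R (x : A) : Prop :=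
  exists2 p : {poly A}, p \is monic /\ p \is a polyOver [in R] & root p x.

Definition integral_closure R S : set A := [set x | S x /\ integral_over R x].

End RingExtensions.

(* Main.v *)
(* Write R' for the integral closure of R in S. By FCP, every t in an
   intermediate ring T satisfies a polynomial over R with a coefficient 1, so
   that T is a Pruefer extension of B = T \cap R': there are a, b in B such that
   a t and b t are in B and a + b t = 1. Applying FCP to the rings B + b^n W, the
   sum T + W is a ring for each ring W between B and R'.
   Given T and U, the sum W of T \cap R' and U \cap R' is a ring by assumption,
   hence so are T + W and U + W, and both are contained in T + U. For t in T and
   u in U, take c, d with c + d u = 1 in U, then a, b with a + b (t d) = 1 in
   T + W, whose intersection with R' is W; this gives
   t u = a (c u) t + b (d u) t^2 + a (t d) u^2, which is in T + U. *)
Require Import Defs.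
From HB Require Import structures.
From mathcomp Require Import all_boot all_algebra all_classical.
From mathcomp Require Import ring.

Set Implicit Arguments.
Unset Strict Implicit.
Unset Printing Implicit Defensive.

Import GRing.Theory.

Local Open Scope classical_set_scope.
Local Open Scope ring_scope.

Lemma polyOver_setP (A : comNzRingType) (T : set A) (p : {poly A}) : T 0 ->
  p \is a polyOver [in T] <-> forall i, T p`_i.
Proof.
rewrite qualifE /= => T0; split=> [/allP pT i | pT]; last first.
  by apply/allP => _ /(nthP 0)[i _ <-]; apply/mem_set.
by have [/(mem_nth 0)/pT/set_mem | /(nth_default 0)->] := ltnP i (size p).
Qed.

(** * Subrings as ring types, and integrality over them *)

Section SubringType.
Variables (A : comNzRingType) (R : set A).

(** The closure proof is an argument so that the structure instances below can be attached to the
    predicate. *)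
Definition subring_pred of is_subring R : pred A := fun x => x \in R.

Variable subringR : is_subring R.

HB.instance Definition _ :=
  GRing.isSubringClosed.Build A (subring_pred subringR) subringR.

Record subring_type :=
  Subring { subring_val : A; _ : subring_val \in subring_pred subringR }.

HB.instance Definition _ := [isSub for subring_val].
HB.instance Definition _ := [Choice of subring_type by <:].
HB.instance Definition _ :=
  [SubChoice_isSubComNzRing of subring_type by <:].

(** Transfers the theory of [integralOver] to subsets: coefficients lying in [R] lift to
    [subring_type]. *)
Lemma integral_overE (x : A) :
  integral_over R x <-> integralOver (val : subring_type -> A) x.
Proof.
have R0 : R 0 by have /set_mem := valP (0 : subring_type); rewrite rmorph0.
split=> [[p [p_mon pR] px0] | [p p_mon px0]]; last first.
  exists (map_poly val p) => //; split; first exact: monic_map.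
  by apply/(polyOver_setP _ R0) => i; rewrite coef_map; apply/set_mem/valP.
have {}pR i : p`_i \in subring_pred subringR.
  by apply/mem_set; move/(polyOver_setP _ R0): pR.
pose q : {poly subring_type} := \poly_(i < size p) insubd 0 p`_i.
have qE : map_poly val q = p.
  apply/polyP => i; rewrite coef_map coef_poly.
  case: ltnP => [_ | /(nth_default 0)->]; last exact: rmorph0.
  exact: insubdK.
exists q; last by rewrite qE.
apply/monicP/val_inj; rewrite -lead_coef_map_inj ?qE ?rmorph1 //.
exact/monicP.
Qed.

Lemma integral_over_id (x : A) : R x -> integral_over R x.
Proof.
move=> Rx; have xR : x \in subring_pred subringR by apply/mem_set.
by apply/integral_overE; have := integral_id val (Subring xR).
Qed.

Lemma integral_over_trans (p : {poly A}) (x : A) :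
  p \is monic -> root p x -> (forall i, integral_over R p`_i) ->
  integral_over R x.
Proof.
move=> p_mon px0 pR; apply/integral_overE.
apply: (@integral_root_monic _ A (val : {rmorphism subring_type -> A})) p_mon px0 _.
by apply/integral_poly => i; apply/integral_overE.
Qed.

Lemma integral_closure_subring : is_subring (integral_closure R [set: A]).
Proof.
split=> [|x y|x y]; rewrite !inE.
- by split=> //; apply: integral_over_id; case: subringR => /set_mem.
- move=> [_ /integral_overE xR] [_ /integral_overE yR]; split=> //.
  exact/integral_overE/(@integral_sub _ A (val : {rmorphism subring_type -> A})).
- move=> [_ /integral_overE xR] [_ /integral_overE yR]; split=> //.
  exact/integral_overE/(@integral_mul _ A (val : {rmorphism subring_type -> A})).
Qed.

End SubringType.

Section RingExtensions.
Variable A : comNzRingType.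
Implicit Types (R S T U W : set A) (x y : A).

(** * Closure properties of subrings and of their sums *)

Section Subring.
Variable T : set A.
Hypothesis subringT : is_subring T.

Lemma subring1 : T 1.
Proof. by case: subringT => /set_mem. Qed.

Lemma subringB x y : T x -> T y -> T (x - y).
Proof. by case: subringT => _ TB _ Tx Ty; apply/set_mem/TB; apply/mem_set. Qed.

Lemma subringM x y : T x -> T y -> T (x * y).
Proof. by case: subringT => _ _ TM Tx Ty; apply/set_mem/TM; apply/mem_set. Qed.

Lemma subring0 : T 0.
Proof. by rewrite -(subrr 1); apply: subringB; apply: subring1. Qed.

Lemma subringN x : T x -> T (- x).
Proof. by rewrite -sub0r => Tx; apply: subringB => //; apply: subring0. Qed.

Lemma subringD x y : T x -> T y -> T (x + y).
Proof. by move=> Tx Ty; rewrite -[y]opprK; apply: subringB => //; apply: subringN. Qed.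

Lemma subringX x n : T x -> T (x ^+ n).
Proof.
by move=> Tx; elim: n => [|n IHn]; rewrite ?exprS; [apply: subring1 | apply: subringM].
Qed.

Lemma subring_horner (p : {poly A}) x :
  (forall i, T p`_i) -> T x -> T p.[x].
Proof.
move=> pT Tx; rewrite horner_coef.
apply: (big_ind T) => [|y z|i _]; [exact: subring0 | exact: subringD |].
by apply: subringM; [apply: pT | apply: subringX].
Qed.

End Subring.

Lemma is_subring_intro T :
  T 1 -> (forall x y, T x -> T y -> T (x - y)) ->
  (forall x y, T x -> T y -> T (x * y)) -> is_subring T.
Proof.
move=> T1 TB TM; split=> [|x y|x y]; rewrite ?inE //; [exact: TB | exact: TM].
Qed.

Lemma subringI T U : is_subring T -> is_subring U -> is_subring (T `&` U).
Proof.
move=> rT rU; apply: is_subring_intro => [|x y [Tx Ux] [Ty Uy]|x y [Tx Ux] [Ty Uy]].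
- by split; apply: subring1.
- by split; apply: subringB.
- by split; apply: subringM.
Qed.

Lemma subset_sumsetl T U : is_subring U -> T `<=` sumset T U.
Proof. by move=> rU x Tx; exists x => //; exists 0; rewrite ?addr0 //; apply: subring0. Qed.

Lemma subset_sumsetr T U : is_subring T -> U `<=` sumset T U.
Proof. by move=> rT x Ux; exists 0; [apply: subring0 | exists x; rewrite ?add0r]. Qed.

Lemma sumsetC T U : sumset T U = sumset U T.
Proof.
by apply/seteqP; split=> _ [x Tx [y Uy <-]]; exists y => //; exists x => //; rewrite addrC.
Qed.

Lemma sumsetD T U x y : is_subring T -> is_subring U ->
  sumset T U x -> sumset T U y -> sumset T U (x + y).
Proof.
move=> rT rU [t Tt [u Uu <-]] [t' Tt' [u' Uu' <-]].
by exists (t + t'); [apply: subringD | exists (u + u'); [apply: subringD | ring]].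
Qed.

(** Expanding [(t + u) * (t' + u')], only the mixed products can leave the sum. *)
Lemma sumset_subring T U : is_subring T -> is_subring U ->
  (forall t u, T t -> U u -> sumset T U (t * u)) -> is_subring (sumset T U).
Proof.
move=> rT rU TUm; have [sTX sUX] := (@subset_sumsetl T U rU, @subset_sumsetr T U rT).
apply: is_subring_intro.
- by apply: sTX; apply: subring1.
- move=> _ _ [t Tt [u Uu <-]] [t' Tt' [u' Uu' <-]].
  by exists (t - t'); [apply: subringB | exists (u - u'); [apply: subringB | ring]].
move=> _ _ [t Tt [u Uu <-]] [t' Tt' [u' Uu' <-]].
have -> : (t + u) * (t' + u') = (t * t' + u * u') + (t * u' + t' * u) by ring.
apply: (sumsetD rT rU); apply: (sumsetD rT rU); try exact: TUm.
- by apply: sTX; apply: subringM.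
- by apply: sUX; apply: subringM.
Qed.

(** * Descending chains, denominators and sums with integral rings *)

(** A strictly decreasing sequence would embed [nat] into its range, a chain and hence finite. *)
Lemma FCP_stationary R S (F : nat -> set A) : FCP R S ->
  (forall n, intermediate_rings R S (F n)) -> (forall n, F n.+1 `<=` F n) ->
  exists n, F n `<=` F n.+1.
Proof.
move=> fcp FRS Fdecr.
have Fle i j : (i <= j)%N -> F j `<=` F i.
  by move=> /subnK <-; elim: (j - i)%N => // n IHn; apply: subset_trans IHn; apply: Fdecr.
have finF : finite_set (range F).
  apply: fcp => [_ [n _ <-] // | _ _ [i _ <-] [j _ <-]].
  by have [/Fle | /ltnW/Fle] := leqP i j; [right | left].
apply: contrapT => Fstrict.
have Finj i j : (i < j)%N -> F i <> F j.
  by move=> lt_ij eqF; apply: Fstrict; exists i; rewrite {1}eqF; apply: Fle.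
apply: infinite_nat; rewrite -(preimage_range F).
apply: finite_preimage finF => i j _ _ eqF.
by case: (ltngtP i j) => // /Finj; rewrite eqF.
Qed.

(* The coefficient of [p] of index [i] is [b i - x * b i.+1], where [b i] is
   the value at [x] of the Horner quotient [drop_poly i p]. *)
Lemma drop_poly_horner (p : {poly A}) x i :
  (drop_poly i p).[x] = p`_i + (drop_poly i.+1 p).[x] * x.
Proof.
have -> : drop_poly i p = cons_poly p`_i (drop_poly i.+1 p).
  by apply/polyP => -[|j]; rewrite coef_cons !coef_drop_poly //= addnS.
by rewrite horner_cons addrC.
Qed.

(* Multiplying the relation [b i * x ^+ i + ... = 0] by [b i ^+ i.-1] shows that
   [b i * x] is integral over the coefficients of [p] and [b i]. *)
Lemma integral_drop_poly R (p : {poly A}) x i : is_subring R ->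
  (forall j, R p`_j) -> root p x ->
  integral_over R (drop_poly i p).[x] /\
  integral_over R ((drop_poly i p).[x] * x).
Proof.
move=> rR pR px0; pose B := integral_closure R [set: A].
have rB : is_subring B := integral_closure_subring rR.
have pB j : B p`_j by split=> //; apply: integral_over_id.
suff : B (drop_poly i p).[x] /\ B ((drop_poly i p).[x] * x) by case=> -[_ ?] [_ ?].
have mulx j : B (drop_poly j p).[x] -> B ((drop_poly j p).[x] * x).
  case: j => [_|j].
    by rewrite drop_poly0l (rootP px0) mul0r; apply: subring0.
  set b := (drop_poly j.+1 p).[x] => Bb; split=> //.
  pose q := 'X^(j.+1) + \poly_(k < j.+1) (p`_k * b ^+ (j - k)).
  apply: (@integral_over_trans _ _ rR q).
  - by rewrite /q monicE lead_coefDl ?lead_coefXn // size_polyXn ltnS size_poly.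
  - apply/rootP; rewrite /q hornerD hornerXn horner_poly.
    have -> : \sum_(k < j.+1) p`_k * b ^+ (j - k) * (b * x) ^+ k =
              b ^+ j * (take_poly j.+1 p).[x].
      rewrite horner_poly mulr_sumr; apply: eq_bigr => k _.
      have -> : b ^+ j = b ^+ (j - k) * b ^+ k by rewrite -exprD subnK // -ltnS.
      by rewrite exprMn; ring.
    have := rootP px0; rewrite -{1}(poly_take_drop j.+1 p) hornerD hornerM hornerXn -/b.
    move=> /eqP; rewrite addr_eq0 => /eqP ->.
    by rewrite exprMn exprS; ring.
  - move=> k; suff [] : B q`_k by [].
    rewrite /q coefD coefXn coef_poly; apply: (subringD rB).
      by case: (_ == _); [apply: subring1 | apply: subring0].
    case: ifP => _; last exact: subring0.
    by apply: subringM => //; apply: subringX.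
(* Downward induction on [j]: the quotient vanishes from [size p] on, and one Horner step with
   [mulx] passes from [j.+1] to [j]. *)
suff Bi j : B (drop_poly j p).[x] by split; [|apply: mulx].
have [n] := ubnP (size p - j)%N; elim: n j => // n IHn j.
have [le_pj _ | lt_jp] := leqP (size p) j.
  by rewrite drop_poly_eq0 // horner0; apply: subring0.
rewrite ltnS => le_n; rewrite drop_poly_horner.
apply: subringD => //; apply/mulx/IHn.
by rewrite subnS prednK ?subn_gt0.
Qed.

(* The ideal of the denominators of [t] is invertible: [T] is a Pruefer
   extension of the integral closure of [R] in [T]. *)
Lemma prufer_denominators R T t :
    is_subring R -> FCP R [set: A] -> intermediate_rings R [set: A] T -> T t ->
  let B := T `&` integral_closure R [set: A] in
  exists a b, [/\ B a, B b, B (a * t), B (b * t) & a + b * t = 1].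
Proof.
move=> rR fcp [rT sRT _] Tt B.
(* [F n] is the ring [R[t ^+ (2 ^ n)]]; stationarity writes [t ^+ (2 ^ n)] as a polynomial in its
   own square. *)
pose F n : set A := [set y | exists2 p : {poly A},
  (forall i, R p`_i) & y = p.[t ^+ (2 ^ n)]].
have Rsum := big_ind R (subring0 rR) (@subringD R rR).
have [n Fn] : exists n, F n `<=` F n.+1.
  apply: (FCP_stationary fcp) => [n|n _ [p pR ->]].
    split=> //.
      apply: is_subring_intro => [|_ _ [p pR ->] [q qR ->]|_ _ [p pR ->] [q qR ->]].
      - exists 1 => [i|]; rewrite ?hornerC // coefC.
        by case: (_ == _); [apply: subring1 | apply: subring0].
      - exists (p - q) => [i|]; rewrite ?hornerD ?hornerN // coefB.
        exact: subringB.
      - exists (p * q) => [i|]; rewrite ?hornerM // coefM.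
        by apply: Rsum => j _; apply: subringM.
    move=> y Ry; exists y%:P => [i|]; rewrite ?hornerC // coefC.
    by case: (_ == _) => //; apply: subring0.
  exists (p \Po 'X^2) => [i|].
    by rewrite coef_comp_poly_Xn //; case: ifP => // _; apply: subring0.
  by rewrite horner_comp hornerXn -exprM -expnSr.
have [] : F n.+1 (t ^+ (2 ^ n)).
  apply: Fn; exists 'X => [i|]; rewrite ?hornerX // coefX.
  by case: (_ == _); [apply: subring1 | apply: subring0].
move=> p pR tE; pose m := (2 ^ n)%N.
(* The exponents from the composed term are multiples of [2 * m], so the coefficient of index [m]
   remains 1. *)
pose q := 'X^m - (p \Po 'X^(2 ^ n.+1)).
have qR i : R q`_i.
  rewrite coefB coefXn coef_comp_poly_Xn ?expn_gt0 //; apply: subringB => //.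
    by case: (_ == _); [apply: subring1 | apply: subring0].
  by case: ifP => // _; apply: subring0.
have qt0 : root q t.
  by apply/rootP; rewrite hornerD hornerN horner_comp !hornerXn -tE subrr.
have qm1 : q`_m = 1.
  rewrite coefB coefXn eqxx coef_comp_poly_Xn ?expn_gt0 //.
  by rewrite gtnNdvd ?subr0 ?expn_gt0 // ltn_exp2l.
have Tq i : T (drop_poly i q).[t].
  by apply: subring_horner => // j; rewrite coef_drop_poly; apply: sRT.
(* With [b_i] the value of [drop_poly i q] at [t], the Horner step at [m] reads
   [b_m = 1 + b_(m+1) * t]. *)
exists (drop_poly m q).[t], (- (drop_poly m.+1 q).[t]); rewrite mulNr.
have rB : is_subring B := subringI rT (integral_closure_subring rR).
have Bq i : B (drop_poly i q).[t] /\ B ((drop_poly i q).[t] * t).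
  have [int_b int_bt] := integral_drop_poly i rR qR qt0.
  by split; split=> //; apply: subringM.
have [[Ba Bat] [Bb Bbt]] := (Bq m, Bq m.+1).
split=> //; try exact: subringN.
by rewrite drop_poly_horner qm1 addrK.
Qed.

(* With [1 = a + b * t] as in [prufer_denominators], stationarity of the rings
   [B + b ^+ n W] lets one divide by [b]. *)
Lemma sumset_integral_subring R T W :
    is_subring R -> FCP R [set: A] -> intermediate_rings R [set: A] T ->
    is_subring W -> T `&` integral_closure R [set: A] `<=` W ->
  is_subring (sumset T W).
Proof.
move=> rR fcp RT rW sBW; have [rT sRT _] := RT.
apply: sumset_subring => // t w Tt Ww.
have [a [b [Ba Bb Bat Bbt abt]]] := prufer_denominators rR fcp RT Tt.
set B := _ `&` _ in sBW Ba Bb Bat Bbt.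
have rB : is_subring B := subringI rT (integral_closure_subring rR).
pose F n : set A := [set y | exists p v, [/\ B p, W v & y = p + b ^+ n * v]].
have Wbn n v : W v -> W (b ^+ n * v).
  by move=> Wv; apply: subringM => //; apply: subringX => //; apply: sBW.
have [n Fn] : exists n, F n `<=` F n.+1.
  apply: (FCP_stationary fcp) => [n|n _ [p [v [Bp Wv ->]]]]; last first.
    exists p, (b * v); split=> //; last by rewrite exprSr mulrA.
    by apply: subringM => //; apply: sBW.
  split=> [||//].
    apply: is_subring_intro => [|_ _ [p [v [Bp Wv ->]]] [q [u [Bq Wu ->]]]
                                |_ _ [p [v [Bp Wv ->]]] [q [u [Bq Wu ->]]]].
    - by exists 1, 0; split; [apply: subring1 | apply: subring0 | rewrite mulr0 addr0].
    - exists (p - q), (v - u); split; [exact: subringB | exact: subringB |].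
      by rewrite mulrBr; ring.
    - exists (p * q), (p * u + q * v + b ^+ n * v * u).
      split; [exact: subringM | | by ring].
      have [Wp Wq] := (sBW p Bp, sBW q Bq).
      by apply: subringD; [| apply: subringD | apply: subringM; [|apply: Wbn|]];
        rewrite //; apply: subringM.
  move=> y Ry; exists y, 0; split; [|exact: subring0 | by rewrite mulr0 addr0].
  by split; [apply: sRT | split=> //; apply: integral_over_id].
have [p [v [Bp Wv bwE]]] : F n.+1 (b ^+ n * w).
  by apply: Fn; exists 0, w; split; [apply: subring0 | | rewrite add0r].
(* Since [a = 1 - b * t], [x] is the geometric sum of the powers of [b * t] below [n]. *)
have [x Bx xE] : exists2 x, B x & a * x + (b * t) ^+ n = 1.
  elim: (n) => [|k [x Bx xE]].
    by exists 0; [apply: subring0 | rewrite mulr0 add0r].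
  exists (1 + b * t * x).
    by apply: subringD; [|apply: subring1 | apply: subringM].
  by rewrite -[RHS]abt -[in RHS](mulr1 (b * t)) -[in RHS]xE exprS; ring.
have [[Wat Wbt] Wx] := (sBW _ Bat, sBW _ Bbt, sBW _ Bx).
(* Multiply [t * w] by [a * x + (b * t) ^+ n = 1] and replace [b ^+ n * w] by
   [p + b ^+ n.+1 * v]. *)
exists (t ^+ n.+1 * p).
  by apply: subringM => //; [apply: subringX | case: Bp].
exists (a * t * x * w + (b * t) ^+ n.+1 * v).
  apply: subringD => //; apply: subringM => //; last exact: subringX.
  by do 2!apply: subringM => //.
transitivity (a * t * x * w + t ^+ n.+1 * (p + b ^+ n.+1 * v)).
  by rewrite exprMn; ring.
rewrite -bwE -[RHS]mul1r -xE exprMn exprS; ring.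
Qed.

End RingExtensions.

(** * Passage between the extension and its integral part *)

Theorem theorem4p5 (S : comNzRingType) (R : set S)
    (subringR : is_subring R) (fcpRS : FCP R [set: S]) :
  Delta_extension R [set: S] <->
  Delta_extension R (integral_closure R [set: S]).
Proof.
set C := integral_closure R [set: S].
have rC : is_subring C := integral_closure_subring subringR.
split=> DRS T U RT RU.
  have [[rT sRT sTC] [rU sRU sUC]] := (RT, RU).
  have [rTU sRTU _] : intermediate_rings R [set: S] (sumset T U) by apply: DRS.
  split=> // _ [t Tt [u Uu <-]].
  by apply: (subringD rC); [apply: sTC | apply: sUC].
have [[rT sRT _] [rU sRU _]] := (RT, RU).
have RI V : intermediate_rings R [set: S] V -> intermediate_rings R C (V `&` C).
  case=> rV sRV _; split; [exact: subringI | | by move=> x []].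
  by move=> x Rx; split; [apply: sRV | split=> //; apply: integral_over_id].
set W := sumset (T `&` C) (U `&` C).
have [rW sRW sWC] : intermediate_rings R C W by apply: DRS; apply: RI.
have sTW : T `&` C `<=` W by apply: subset_sumsetl; case: (RI U RU).
have sUW : U `&` C `<=` W by apply: subset_sumsetr; case: (RI T RT).
have rE : is_subring (sumset T W) by apply: (sumset_integral_subring subringR).
have rG : is_subring (sumset U W) by apply: (sumset_integral_subring subringR).
have sTE : T `<=` sumset T W by apply: subset_sumsetl.
have sWE : W `<=` sumset T W by apply: subset_sumsetr.
have sEX : sumset T W `<=` sumset T U.
  move=> _ [t Tt [_ [t' [Tt' _] [u [Uu _] <-]] <-]].
  by exists (t + t'); [apply: subringD | exists u => //; rewrite addrA].
have sGX : sumset U W `<=` sumset T U.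
  move=> _ [u Uu [_ [t [Tt _] [u' [Uu' _] <-]] <-]].
  by exists t => //; exists (u + u'); [apply: subringD | rewrite addrCA].
(* If [t + w] is integral then so is [t], because [W] lies in [C]; hence [t] is in [W]. *)
have sECW : sumset T W `&` C `<=` W.
  move=> _ [[t Tt [w Ww <-]] Ctw]; apply: subringD => //; apply: sTW; split=> //.
  by rewrite -(addrK w t); apply: subringB => //; apply: sWC.
have RE : intermediate_rings R [set: S] (sumset T W).
  by split=> // x /sRT; apply: sTE.
split=> [|x /sRT|//]; last exact: subset_sumsetl.
apply: sumset_subring => // t u Tt Uu.
have [c [d [Uc Ud Ucu Udu cdu]]] := prufer_denominators subringR fcpRS RU Uu.
have Etd : sumset T W (t * d) by apply: (subringM rE); [apply: sTE | apply/sWE/sUW].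
have [a [b [/sECW Wa /sECW Wb /sECW Watd /sECW Wbtd abtd]]] :=
  prufer_denominators subringR fcpRS RE Etd.
(* Multiply [t * u] by [a + b * (t * d) = 1], then the term in [a] by [c + d * u = 1]. The
   coefficients of [t] and [t * t] lie in [W], and so does that of [u * u], so the rings [T + W] and
   [U + W] absorb the terms. *)
have -> : t * u = a * (c * u) * t + (b * (d * u) * (t * t) + a * (t * d) * (u * u)).
  rewrite -[LHS]mul1r -abtd mulrDl -[X in X + _]mulr1 -[in X in X + _]cdu; ring.
have mulE w x : W w -> T x -> sumset T U (w * x).
  by move=> Ww Tx; apply/sEX/(subringM rE); [apply: sWE | apply: sTE].
have mulG w x : W w -> U x -> sumset T U (w * x).
  move=> Ww Ux; apply/sGX/(subringM rG); first exact: subset_sumsetr.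
  exact: subset_sumsetl.
apply: sumsetD => //; [|apply: sumsetD => //].
- by apply: mulE => //; apply: subringM => //; apply: sUW.
- by apply: mulE; apply: subringM => //; apply: sUW.
- by apply: mulG => //; apply: subringM.
Qed.
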